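(* Let $X$ be a complex Fréchet space which admits a continuous norm. Then every operator $T$ on $X \oplus \omega$ possesses a closed almost-invariant half-space if and only if $X$ is infinite-dimensional.
   Context: Here $\omega = \mathbb{C}^{\mathbb{Z}_+}$ ($\mathbb{Z}_+$ the non-negative integers) is the Fréchet space of all complex sequences, with topology given by the seminorms $p_j(x) = \max_{0\le n \le j}|x_n|$, $j \ge 0$. An operator on a Fréchet space $Y$ is a continuous linear map $Y \to Y$. A half-space of $Y$ is a linear subspace of infinite dimension and infinite codimension in $Y$. A subspace $M$ of $Y$ is almost-invariant for an operator $T$ on $Y$ if there exists a (continuous) finite rank operator $R$ on $Y$ such that $(T+R)(M) \subseteq M$. The Fréchet space $X$ has a continuous norm if there is a norm on $X$ that is continuous for the topology of $X$. *)

(* Defs.v *)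
From HB Require Import structures.
From mathcomp Require Import all_boot all_order all_algebra.
From mathcomp Require Import all_classical all_reals all_analysis.
From mathcomp.real_closed Require Import complex.
Set Implicit Arguments.
Unset Strict Implicit.
Unset Printing Implicit Defensive.

Import Order.TTheory GRing.Theory Num.Theory.
Import numFieldNormedType.Exports.

Local Open Scope classical_set_scope.
Local Open Scope ring_scope.
Local Open Scope complex_scope.

(* [Normc.normc z] is the modulus of [z : R[i]] as an element of [R], whereas
   [`|z|] is the same number seen in [R[i]]. *)
Notation cmod := Normc.normc.

Section LinearAlgebra.
Variables (K : fieldType) (V : lmodType K).

Definition fin_dim (M : set V) :=
  exists (n : nat) (v : 'I_n -> V), (forall i, M (v i)) /\
    forall x, M x -> exists a : 'I_n -> K, x = \sum_i a i *: v i.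

(* The classes of the [v i] span the quotient [V / M]. *)
Definition fin_codim (M : set V) :=
  exists (n : nat) (v : 'I_n -> V),
    forall x, exists a : 'I_n -> K, M (x - \sum_i a i *: v i).

Definition half_space (M : set V) :=
  [/\ submod_closed (mem M), ~ fin_dim M & ~ fin_codim M].

End LinearAlgebra.

Definition almost_invariant (K : numFieldType) (Y : preTopologicalLmodType K)
    (T : Y -> Y) (M : set Y) :=
  exists F : {linear Y -> Y}, [/\ continuous F, fin_dim (range F)
    & forall x, M x -> M (T x + F x)].

Section Frechet.
Variables (R : realType) (X : tvsType R[i]).

(* A uniform structure carried by a [tvsType] need not be the
   translation-invariant one, so completeness is not stated through the
   library's [cauchy], but for an invariant metric inducing the topology. *)
Definition frechet :=
  exists d : X -> X -> R,
    [/\ (forall x y, d x y = 0 <-> x = y) /\ (forall x y, d x y = d y x),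
        forall x y z, d x z <= d x y + d y z,
        forall x y z, d (x + z) (y + z) = d x y,
        forall x, nbhs x = filter_from [set e : R | 0 < e]
                             (fun e => [set y | d x y < e])
      & forall u : nat -> X,
          (forall e : R, 0 < e -> exists N : nat,
             forall m n, (N <= m)%N -> (N <= n)%N -> d (u m) (u n) < e) ->
          exists l : X, u @ \oo --> l].

Definition is_norm (p : X -> R) :=
  [/\ forall x, p x = 0 -> x = 0,
      forall x y, p (x + y) <= p x + p y
    & forall (a : R[i]) x, p (a *: x) = cmod a * p x].

Definition has_continuous_norm :=
  exists p : X -> R, is_norm p /\ continuous p.

End Frechet.

Section Omega.
Variable R : realType.

Definition omega : Type := nat -> R[i].

HB.instance Definition _ := GRing.Lmodule.copy omega (nat -> R[i]).

Definition omega_seminorm (j : nat) (x : omega) : R :=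
  \big[Num.max/0]_(n < j.+1) cmod (x n).

Definition omega_ball (x : omega) (j : nat) (e : R) : set omega :=
  [set y | omega_seminorm j (x - y) < e].

Definition omega_nbhs (x : omega) : set_system omega :=
  [set A | exists (j : nat) (e : R), 0 < e /\ omega_ball x j e `<=` A].

HB.instance Definition _ := hasNbhs.Build omega omega_nbhs.

Let cmodD (x y : R[i]) : cmod (x + y) <= cmod x + cmod y.
Proof. exact: le_normcD. Qed.

Let cmod_ge0 (x : R[i]) : 0 <= cmod x.
Proof. by case: x => a b; rewrite sqrtr_ge0. Qed.

Lemma omega_seminorm_ltP j (x : omega) (e : R) : 0 < e ->
  omega_seminorm j x < e <-> forall n, (n <= j)%N -> cmod (x n) < e.
Proof.
move=> e0; split=> [/bigmax_ltP[_ xe] n nj|xe].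
  exact: (xe (Ordinal (n:=j.+1) (m:=n) nj)).
by apply/bigmax_ltP; split=> // i _; apply: xe; rewrite -ltnS.
Qed.

Lemma omega_seminorm_leP j (x : omega) (e : R) : 0 <= e ->
  omega_seminorm j x <= e <-> forall n, (n <= j)%N -> cmod (x n) <= e.
Proof.
move=> e0; split=> [/bigmax_leP[_ xe] n nj|xe].
  exact: (xe (Ordinal (n:=j.+1) (m:=n) nj)).
by apply/bigmax_leP; split=> // i _; apply: xe; rewrite -ltnS.
Qed.

Lemma omega_seminorm_ge0 j x : 0 <= omega_seminorm j x.
Proof. exact: bigmax_ge_id. Qed.

Lemma omega_seminorm_ge j (x : omega) n :
  (n <= j)%N -> cmod (x n) <= omega_seminorm j x.
Proof. exact: (omega_seminorm_leP j x (omega_seminorm_ge0 j x)).1. Qed.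

Lemma omega_seminorm0 j : omega_seminorm j 0 = 0.
Proof.
apply/le_anti; rewrite omega_seminorm_ge0 andbT.
by apply/omega_seminorm_leP => // n _; rewrite Normc.normc0.
Qed.

Lemma omega_seminormD j x y :
  omega_seminorm j (x + y) <= omega_seminorm j x + omega_seminorm j y.
Proof.
apply/omega_seminorm_leP; first by rewrite addr_ge0 ?omega_seminorm_ge0.
move=> n nj; apply: le_trans (cmodD _ _) _.
by rewrite lerD// omega_seminorm_ge.
Qed.

Lemma omega_seminormZ j (a : R[i]) x :
  omega_seminorm j (a *: x) = cmod a * omega_seminorm j x.
Proof.
apply/le_anti/andP; split.
  apply/omega_seminorm_leP; first by rewrite mulr_ge0 ?omega_seminorm_ge0.
  by move=> n nj; rewrite Normc.normcM ler_wpM2l// omega_seminorm_ge.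
have [->|a0] := eqVneq a 0.
  by rewrite Normc.normc0 mul0r omega_seminorm_ge0.
have ca0 : 0 < cmod a.
  by rewrite lt_neqAle cmod_ge0 andbT eq_sym; apply: contra a0
    => /eqP/Normc.eq0_normc ->.
rewrite mulrC -ler_pdivlMr//; apply/omega_seminorm_leP.
  by rewrite divr_ge0 ?omega_seminorm_ge0.
move=> n nj; rewrite ler_pdivlMr// mulrC -Normc.normcM.
exact: (omega_seminorm_ge (a *: x)).
Qed.

Lemma omega_seminormB j x y : omega_seminorm j (x - y) = omega_seminorm j (y - x).
Proof.
by rewrite -opprB -scaleN1r omega_seminormZ normcN Normc.normc1 mul1r.
Qed.

Lemma omega_seminorm_mono i j x :
  (i <= j)%N -> omega_seminorm i x <= omega_seminorm j x.
Proof.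
move=> ij; apply/omega_seminorm_leP => [|n ni]; first exact: omega_seminorm_ge0.
by apply: omega_seminorm_ge; exact: leq_trans ni ij.
Qed.

Lemma omega_ball_center x j e : 0 < e -> omega_ball x j e x.
Proof. by rewrite /omega_ball/= subrr omega_seminorm0. Qed.

Let nbhs_filter (x : omega) : ProperFilter (nbhs x).
Proof.
split; first by move=> [j [e [e0 /(_ x)]]]; apply; exact: omega_ball_center.
split; first by exists 0%N, 1.
  move=> P Q [i [e [e0 eP]]] [j [f [f0 fQ]]].
  exists (maxn i j), (Num.min e f); split; first by rewrite lt_min e0.
  move=> y; rewrite /omega_ball/= lt_min => /andP[ye yf]; split.
    by apply/eP/(le_lt_trans _ ye)/omega_seminorm_mono/leq_maxl.
  by apply/fQ/(le_lt_trans _ yf)/omega_seminorm_mono/leq_maxr.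
by move=> P Q PQ [j [e [e0 eP]]]; exists j, e; split=> // y /eP /PQ.
Qed.

Let nbhs_singleton (x : omega) (A : set omega) : nbhs x A -> A x.
Proof. by move=> [j [e [e0]]]; apply; exact: omega_ball_center. Qed.

Lemma omega_ball_nbhs x j e y : omega_ball x j e y -> nbhs y (omega_ball x j e).
Proof.
move=> xy; exists j, (e - omega_seminorm j (x - y)).
split; first by rewrite subr_gt0.
move=> z; rewrite /omega_ball/= ltrBrDl; apply: le_lt_trans.
by rewrite -[x - z](subrKA y) omega_seminormD.
Qed.

Let nbhs_nbhs (x : omega) (A : set omega) : nbhs x A -> nbhs x (nbhs^~ A).
Proof.
move=> [j [e [e0 eA]]]; exists j, e; split=> // y /omega_ball_nbhs.
by move=> [k [f [f0 fA]]]; exists k, f; split=> // z /fA /eA.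
Qed.

HB.instance Definition _ := Nbhs_isNbhsTopological.Build omega
  nbhs_filter nbhs_singleton nbhs_nbhs.

Let add_cont : continuous (fun x : omega * omega => x.1 + x.2).
Proof.
move=> [x y] A [j [e [e0 eA]]].
exists (omega_ball x j (e / 2), omega_ball y j (e / 2)).
  by split; exists j, (e / 2); split=> //; rewrite divr_gt0.
move=> [x' y'] [/= xx' yy']; apply: eA; rewrite /omega_ball/=.
rewrite opprD addrACA (le_lt_trans (omega_seminormD _ _ _))//.
by rewrite (splitr e) ltrD.
Qed.

Let scale_cont : continuous (fun z : R[i]^o * omega => z.1 *: z.2).
Proof.
move=> [a x] A [j [e [e0 eA]]].
pose M := omega_seminorm j x + 1.
have M0 : 0 < M by rewrite ltr_wpDl ?omega_seminorm_ge0.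
have a1 : 0 < cmod a + 1 by rewrite ltr_wpDl.
pose r : R := Num.min 1 (e / 2 / M).
have r0 : 0 < r by rewrite lt_min ltr01 !divr_gt0.
pose s := e / 2 / (cmod a + 1).
have s0 : 0 < s by rewrite !divr_gt0.
exists ([set b : R[i]^o | cmod (a - b) < r], omega_ball x j s).
  split; last by exists j, s; split.
  exists (r%:C) => /=; first by rewrite ltcR.
  by move=> b /=; rewrite ltcR.
move=> [b y] [/= ab xy]; apply: eA; rewrite /omega_ball/=.
have -> : a *: x - b *: y = (a - b) *: x + b *: (x - y).
  by rewrite scalerBl scalerBr [RHS]addrA subrK.
rewrite (le_lt_trans (omega_seminormD _ _ _))// !omega_seminormZ (splitr e).
apply: ltr_leD.
  apply: (@le_lt_trans _ _ (cmod (a - b) * M)).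
    by rewrite ler_wpM2l// lerDl.
  by rewrite -ltr_pdivlMr//; apply: lt_le_trans ab _; rewrite ge_min lexx orbT.
have ba : cmod b <= cmod a + 1.
  rewrite -[b](subrK a) addrC (le_trans (cmodD _ _))// lerD2l -normcN opprB.
  by apply/ltW/(lt_le_trans ab); rewrite ge_min lexx.
apply: (@le_trans _ _ ((cmod a + 1) * omega_seminorm j (x - y))).
  by rewrite ler_wpM2r// omega_seminorm_ge0.
by rewrite mulrC -ler_pdivlMr// ltW.
Qed.

Let cmod_real (t : R[i]) : 0 <= t -> t = (cmod t)%:C.
Proof. by move=> t0; rewrite -[LHS](ger0_norm t0). Qed.

Let omega_locally_convex : exists2 B : set_system omega,
  (forall b, b \in B -> convex_set b) & basis B.
Proof.
exists [set B | exists x j e, B = omega_ball x j e].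
  move=> b; rewrite inE => -[x [j [e ->]]]; apply/convex_setW => y z.
  rewrite !inE => xy xz k k0 k1.
  rewrite inE /omega_ball/=.
  pose t : R[i] := k%:num.
  rewrite (_ : x - _ = t *: (x - y) + (1 - t) *: (x - z)); last first.
    by rewrite !scalerBr addrACA -scalerDl subrKC scale1r -opprD.
  rewrite (le_lt_trans (omega_seminormD _ _ _))// !omega_seminormZ.
  have t0 : 0 < cmod t by rewrite -ltcR -cmod_real// ltW.
  have t1 : 0 < cmod (1 - t).
    by rewrite -ltcR -cmod_real ?subr_gt0// subr_ge0 ltW.
  have te : cmod t + cmod (1 - t) = 1.
    apply: complexI; rewrite rmorphD/= -!cmod_real ?subrKC// ?subr_ge0 ltW//.
  by rewrite -[ltRHS]mul1r -te mulrDl ltrD// ltr_pM2l.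
split=> [B [x [j [e ->]]]|x A [j [e [e0 eA]]]].
  by rewrite openE => y; exact: omega_ball_nbhs.
exists (omega_ball x j e) => //; split; last exact: omega_ball_center.
by exists x, j, e.
Qed.

(* The factory [PreTopologicalLmod_isTvs] only provides the translation-invariant
   uniform structure; the remaining mixins are declared separately. *)
HB.instance Definition _ := PreTopologicalLmod_isTvs.Build R[i] omega
  add_cont scale_cont omega_locally_convex.
HB.instance Definition _ :=
  PreTopologicalNmodule_isTopologicalNmodule.Build omega add_cont.
HB.instance Definition _ :=
  TopologicalNmodule_isTopologicalLmodule.Build R[i] omega scale_cont.
HB.instance Definition _ :=
  Uniform_isTvs.Build R[i] omega omega_locally_convex.

Definition sum_omega (X : tvsType R[i]) : tvsType R[i] := (X * omega)%type.

End Omega.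

(* Main.v *)
From HB Require Import structures.
Require Import Defs.
From mathcomp Require Import all_boot all_order all_algebra.
From mathcomp Require Import all_classical all_reals all_analysis.
From mathcomp.real_closed Require Import complex.

(** If [X] is infinite-dimensional, [{0} * omega] is the half-space: the corner
    [omega -> X] of [T] has finite rank, since composing it with the continuous
    norm gives a seminorm vanishing as soon as finitely many coordinates do.

    If [X] is finite-dimensional, take for [T] the backward shift on [omega].
    Given [M] closed, let [D] be the set of orders (index of the first nonzero
    entry) of the nonzero sequences [w] with [(0, w)] in [M].  [D] is infinite
    when [M] is infinite-dimensional and, [M] being closed, co-infinite when [M]
    is infinite-codimensional.  So infinitely many [n] outside [D] have [n.+1]
    in [D]; a combination of sequences of these orders [n.+1] is killed by the
    finite rank perturbation, and its shift has an order outside [D]. *)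

Set Implicit Arguments.
Unset Strict Implicit.
Unset Printing Implicit Defensive.

Import Order.TTheory GRing.Theory Num.Theory.
Import numFieldNormedType.Exports.

Local Open Scope classical_set_scope.
Local Open Scope ring_scope.

(** * Finite dimension through linear dependence *)

Lemma wide_kernel (K : fieldType) (m n : nat) (A : 'M[K]_(m, n)) : (n < m)%N ->
  exists2 a : 'I_m -> K, (exists i, a i != 0) & forall j, \sum_i a i * A i j = 0.
Proof.
move=> nm; have /rowV0Pn[u uA u0] : kermx A != 0.
  by rewrite kermx_eq0 /row_free neq_ltn (leq_ltn_trans (rank_leq_col A) nm).
exists (u 0); first by have /rV0Pn := u0.
move=> j; move/sub_kermxP: uA => /rowP /(_ j).
by rewrite !mxE.
Qed.

Section LinearDependence.
Variables (K : fieldType) (V : lmodType K).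
Implicit Types M : set V.

Definition lin_dep (n : nat) (x : 'I_n -> V) :=
  exists2 a : 'I_n -> K, (exists i, a i != 0) & \sum_i a i *: x i = 0.

(** A maximal independent family in [M] spans [M], and the bound on sizes guarantees that one
    exists. *)
Lemma fin_dim_lin_dep M (n : nat) :
  (forall x : 'I_n -> V, (forall i, M (x i)) -> lin_dep x) -> fin_dim M.
Proof.
elim: n => [|n IHn] dep.
  have [i|a [[]//]] := dep (fun=> 0); exact: (False_ind _ (notF (ltn_ord i))).
have [/IHn//|/existsNP[x /not_implyP[Mx ind]]] :=
  pselect (forall x : 'I_n -> V, (forall i, M (x i)) -> lin_dep x).
exists n, x; split=> // y My.
(* Here [x] is an independent [n]-family; putting [y] in front at [ord0] gives a dependence whose
   coefficient at [y] cannot vanish. *)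
have [i|a [i ai0] ay] := dep (fun i => oapp x y (unlift ord0 i)).
  by case: unliftP => [j|] _ /=.
rewrite big_ord_recl unlift_none /= in ay.
have a00 : a ord0 != 0.
  apply/eqP => a00; apply: ind; exists (a \o lift ord0).
    case: (unliftP ord0 i) => [j ij|i0]; last by rewrite i0 a00 eqxx in ai0.
    by exists j; rewrite /= -ij.
  move: ay; rewrite a00 scale0r add0r => ay; rewrite -[RHS]ay.
  by apply: eq_bigr => j _; rewrite liftK.
exists (fun i => - (a ord0)^-1 * a (lift ord0 i)).
move/eqP: ay; rewrite addr_eq0 => /eqP/(congr1 ( *:%R (a ord0)^-1)).
rewrite scalerA mulVf// scale1r => ->; rewrite scalerN -scaleNr scaler_sumr.
by apply: eq_bigr => j _; rewrite liftK scalerA.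
Qed.

Lemma submod_closed_sum M (n : nat) (a : 'I_n -> K) (x : 'I_n -> V) :
  submod_closed (mem M) -> (forall i, M (x i)) -> M (\sum_i a i *: x i).
Proof.
move=> [M0 MD] Mx; elim/big_rec: _ => [|i y _ My]; first by rewrite -inE.
by rewrite -inE; apply: MD; rewrite inE.
Qed.

End LinearDependence.

(** The coefficients of more than [n] values on [n] vectors form a matrix with a nontrivial left
    kernel. *)
Lemma fin_dim_lin_dep_comp (K : fieldType) (U V : lmodType K)
    (f : {linear U -> V}) (n m : nat) (v : 'I_n -> V) (x : 'I_m -> U) :
  (n < m)%N -> (forall y, exists a : 'I_n -> K, f y = \sum_i a i *: v i) ->
  lin_dep (f \o x).
Proof.
move=> nm /choice[c fc].
have [a a0 aA] := wide_kernel (\matrix_(i < m, j < n) c (x i) j) nm.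
exists a => //=; under eq_bigr do rewrite fc scaler_sumr.
rewrite exchange_big big1//= => j _.
under eq_bigr do rewrite scalerA.
rewrite -scaler_suml -[RHS](scale0r (v j)); congr (_ *: _); rewrite -[RHS](aA j).
by apply: eq_bigr => i _; rewrite mxE.
Qed.

(** * Orders of sequences and the backward shift *)

Section Omega.
Variable R : realType.
Local Notation omega := (omega R).
Implicit Types (w : omega) (n : nat).

Definition vanishes_below n w := forall k, (k < n)%N -> w k = 0.

Definition has_order n w := vanishes_below n w /\ w n != 0.

Lemma omega_neq0_order w : w != 0 -> exists n, has_order n w.
Proof.
move=> w0; have wn : exists n, w n != 0.
  apply/not_existsP => w00; move/eqP: w0; apply; apply/funext => n.
  by apply/eqP; apply: contra_notT (w00 n).
exists (ex_minn wn); case: ex_minnP => n wn0 nmin; split=> // k kn.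
by apply/eqP; apply: contraTT kn => /nmin; rewrite leqNgt.
Qed.

Definition basis_omega n : omega := fun k => (k == n)%:R.

Lemma sum_basis_omega n w k :
  (\sum_(i < n) w i *: basis_omega i) k = if (k < n)%N then w k else 0.
Proof.
have -> : (\sum_(i < n) w i *: basis_omega i) k = \sum_(i < n) w i * (k == i)%:R.
  by elim/big_rec2: _ => // i y1 y2 _ <-.
case: ltnP => kn.
  rewrite (bigD1 (Ordinal kn))//= eqxx mulr1 big1 ?addr0// => i ik.
  rewrite (_ : (k == i) = false) ?mulr0//; apply: contraNF ik => /eqP ki.
  exact/eqP/val_inj.
by rewrite big1// => i _; rewrite gtn_eqF ?mulr0// (leq_trans (ltn_ord i)).
Qed.

Lemma vanishes_below_sub_sum_basis n w :
  vanishes_below n (w - \sum_(i < n) w i *: basis_omega i).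
Proof.
move=> k kn; rewrite [LHS](_ : _ = w k - (\sum_(i < n) w i *: basis_omega i) k)//.
by rewrite sum_basis_omega kn subrr.
Qed.

Lemma omega_ball_agree j (e : R) w1 w2 : 0 < e ->
  (forall k, (k <= j)%N -> w1 k = w2 k) -> omega_ball w1 j e w2.
Proof.
move=> e0 w12; apply/omega_seminorm_ltP => // k kj.
by rewrite /= (_ : (w1 - w2) k = w1 k - w2 k)// w12// subrr Normc.normc0.
Qed.

Definition shift w : omega := fun n => w n.+1.

Lemma shift_continuous : continuous shift.
Proof.
move=> w A [j [e [e0 eA]]]; exists j.+1, e; split=> // w' /omega_seminorm_ltP ww'.
by apply: eA; apply/omega_seminorm_ltP => // k kj; exact: (ww' e0 k.+1).
Qed.

Lemma shift_order n w : has_order n.+1 w -> has_order n (shift w).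
Proof. by move=> [w0 wn]; split=> // k kn; exact: w0. Qed.

End Omega.

(** * Subspaces of the sum and the orders they contain *)

Section SumOmega.
Variables (R : realType) (X : tvsType R[i]).
Local Notation omega := (omega R).
Local Notation Y := (sum_omega X).
Implicit Types (M : set Y) (w : omega).

(** The set [D] of the opening outline, as a predicate on [n]. *)
Definition omega_order M n := exists2 w, M (0, w) & has_order n w.

Lemma fst_sum (I : finType) (F : I -> Y) : (\sum_i F i).1 = \sum_i (F i).1.
Proof. by elim/big_rec2: _ => // i y1 y2 _ <-. Qed.

Lemma snd_sum (I : finType) (F : I -> Y) : (\sum_i F i).2 = \sum_i (F i).2.
Proof. by elim/big_rec2: _ => // i y1 y2 _ <-. Qed.

Lemma omega_sumE (I : finType) (a : I -> R[i]) (w : I -> omega) n :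
  (\sum_i a i *: w i) n = \sum_i a i * w i n.
Proof. by elim/big_rec2: _ => // i y1 y2 _ <-. Qed.

(** Among [m + N + 1] elements of [M], a nontrivial combination meets [m] conditions killing its
    component in [X] and [N] killing its first [N] entries; were it nonzero, its order would be at
    least [N]. *)
Lemma bounded_order_fin_dim M N :
  fin_dim [set: X] -> submod_closed (mem M) ->
  (forall n, omega_order M n -> (n < N)%N) -> fin_dim M.
Proof.
move=> [m [v [_ vX]]] Msub MN; apply: (@fin_dim_lin_dep _ _ _ (m + N).+1) => y My.
have /choice[c vc] : forall x : X, exists a : 'I_m -> R[i], x = \sum_i a i *: v i.
  by move=> x; exact: vX.
pose A := row_mx (\matrix_(i < (m + N).+1, j < m) c (y i).1 j)
                 (\matrix_(i < (m + N).+1, j < N) (y i).2 j).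
have [a a0 aA] := wide_kernel A (ltnSn _).
exists a => //; set z := \sum_i _.
have Mz : M z by exact: submod_closed_sum.
have z1 : z.1 = 0.
  rewrite fst_sum /=; under eq_bigr do rewrite [(y _).1]vc scaler_sumr.
  rewrite exchange_big big1//= => j _.
  under eq_bigr do rewrite scalerA.
  rewrite -scaler_suml -[RHS](scale0r (v j)); congr (_ *: _).
  rewrite -[RHS](aA (lshift N j)).
  by apply: eq_bigr => i _; rewrite row_mxEl mxE.
have z2 : vanishes_below N z.2.
  move=> k kN; rewrite snd_sum omega_sumE -[RHS](aA (rshift m (Ordinal kN))).
  by apply: eq_bigr => i _; rewrite row_mxEr mxE.
have zE : z = (0, z.2) by rewrite [LHS]surjective_pairing z1.
have [z20|/omega_neq0_order[n nz]] := eqVneq z.2 0; first by rewrite zE z20.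
have /MN nN : omega_order M n by exists z.2 => //; rewrite -zE.
by case: nz => _; rewrite z2 ?eqxx.
Qed.

(** Elements of [M] of orders [N], [N + 1], ... cancel the entries of [w] one by one; the partial
    sums converge to [w], as a neighbourhood in [omega] controls only finitely many entries. *)
Lemma closed_vanishes_below M N w :
  closed M -> submod_closed (mem M) ->
  (forall n, (N <= n)%N -> omega_order M n) -> vanishes_below N w -> M (0, w).
Proof.
move=> Mcl [M0 MD] MN wN.
have approx j : exists2 s, M (0, s) & vanishes_below (N + j) (w - s).
  elim: j => [|j [s Ms sj]].
    by exists 0; [rewrite -inE | rewrite subr0 addn0].
  have [u Mu [u0 uj]] := MN _ (leq_addr j N).
  (* This coefficient clears entry [N + j]; [u] vanishes below it, so the entries already cleared
     stay zero. *)
  pose b := (w - s) (N + j)%N / u (N + j)%N.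
  exists (b *: u + s).
    have -> : ((0, b *: u + s) : Y) = b *: ((0, u) : Y) + (0, s).
      by congr pair; rewrite /= scaler0 addr0.
    by rewrite -inE; apply: MD; rewrite inE.
  have bE k : (w - (b *: u + s)) k = (w - s) k - b * u k.
    by rewrite opprD addrCA addrC.
  move=> k; rewrite addnS ltnS leq_eqVlt bE => /predU1P[->|kj].
    by rewrite mulfVK// subrr.
  by rewrite sj// u0// mulr0 subrr.
apply: Mcl => B [[B1 B2]] /= [B10 [j [e [e0 eB2]]]] B12.
(* A ball of index [j] sees the entries [0] to [j], hence [j.+1]. *)
have [s Ms sj] := approx j.+1; exists (0, s); split=> //; apply: B12; split=> /=.
  exact: nbhs_singleton.
apply/eB2/omega_ball_agree => // k kj; apply/eqP; rewrite -subr_eq0; apply/eqP.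
by apply: sj; rewrite addnS ltnS (leq_trans kj)// leq_addl.
Qed.

(** Modulo a spanning family of [X] and the first [N] unit sequences, every vector vanishes below
    [N] and so lies in [M]. *)
Lemma cofinite_order_fin_codim M N :
  fin_dim [set: X] -> closed M -> submod_closed (mem M) ->
  (forall n, (N <= n)%N -> omega_order M n) -> fin_codim M.
Proof.
move=> [m [v [_ vX]]] Mcl Msub MN.
exists (m + N)%N, (fun i => match fintype.split i with
  | inl j => (v j, 0) | inr k => (0, basis_omega R k) end).
move=> [x w]; have [c xc] := vX x I.
exists (fun i => match fintype.split i with inl j => c j | inr k => w k end).
rewrite big_split_ord/=.
set S := (X in _ - X); have -> : S = (x, \sum_(k < N) w k *: basis_omega R k).
  rewrite /S.
  under eq_bigr do rewrite (unsplitK (inl _)).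
  under [X in _ + X]eq_bigr do rewrite (unsplitK (inr _)).
  rewrite [LHS]surjective_pairing; congr pair.
    rewrite [LHS](_ : _ = (\sum_(i < m) c i *: ((v i, 0) : Y)).1 +
      (\sum_(k < N) w k *: ((0, basis_omega R k) : Y)).1)//.
    by rewrite !fst_sum /= -xc big1 ?addr0// => k _; rewrite scaler0.
  rewrite [LHS](_ : _ = (\sum_(i < m) c i *: ((v i, 0) : Y)).2 +
    (\sum_(k < N) w k *: ((0, basis_omega R k) : Y)).2)//.
  by rewrite !snd_sum /= big1 ?add0r// => k _; rewrite scaler0.
rewrite (_ : _ - _ = (0, w - \sum_(k < N) w k *: basis_omega R k)); last first.
  by congr pair; exact: subrr.
apply: closed_vanishes_below Mcl Msub MN _.
exact: vanishes_below_sub_sum_basis.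
Qed.

(** * The shift when [X] is finite-dimensional *)

Definition sum_shift (y : Y) : Y := (0, shift y.2).

Lemma sum_shift_linear : linear sum_shift.
Proof.
by move=> a y z; apply: injective_projections => //=; rewrite scaler0 addr0.
Qed.

HB.instance Definition _ := GRing.isLinear.Build R[i] Y Y *:%R sum_shift
  sum_shift_linear.

Lemma sum_shift_continuous : continuous sum_shift.
Proof.
move=> y; apply: (@cvg_pair _ _ _ _ (nbhs 0) (nbhs (shift y.2))).
  exact: cvg_cst.
by apply: (@continuous_comp _ _ _ snd (@shift R));
  [exact: cvg_snd | exact: shift_continuous].
Qed.

Lemma unshift_order M :
  fin_dim [set: X] -> closed M -> half_space M ->
  forall N, exists2 n, (N <= n)%N & omega_order M n.+1 /\ ~ omega_order M n.
Proof.
move=> Xfin Mcl [Msub Minf Mcoinf] N.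
have [n Nn nM] : exists2 n, (N <= n)%N & ~ omega_order M n.
  apply: contrapT => NM; apply/Mcoinf/(cofinite_order_fin_codim (N := N)) => // n Nn.
  by apply: contrapT => nM; apply: NM; exists n.
have [d nd] : exists2 d, (n <= d)%N & omega_order M d.
  apply: contrapT => nM'; apply/Minf/(bounded_order_fin_dim (N := n)) => // d dM.
  by rewrite ltnNge; apply/negP => nd; apply: nM'; exists d.
(* Going down from [d] in [D] to [n] outside [D], some step leaves [D]. *)
elim: d nd => [|d IHd]; first by rewrite leqn0 => /eqP n0 M0; rewrite n0 in nM.
rewrite leq_eqVlt => /predU1P[nd dM|nd dM]; first by rewrite nd in nM.
have [Md|nMd] := pselect (omega_order M d); first exact: IHd.
by exists d => //; exact: leq_trans Nn nd.
Qed.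

Lemma sum_shift_not_almost_invariant M :
  fin_dim [set: X] -> closed M -> half_space M -> ~ almost_invariant sum_shift M.
Proof.
move=> Xfin Mcl Mhs [F [_ [r [v [_ Fv]]] MF]].
have Msub : submod_closed (mem M) by case: Mhs.
have /choice[g gP] : forall N, exists n,
    [/\ (N <= n)%N, omega_order M n.+1 & ~ omega_order M n].
  by move=> N; have [n Nn []] := unshift_order Xfin Mcl Mhs N; exists n.
(* Applying [g] past the previous value makes the chosen orders strictly increasing. *)
pose f k := iter k (g \o succn) (g 0).
have f_mono : {homo f : i j / (i < j)%N}.
  by apply: homo_ltn => [? ? ?|i]; [exact: ltn_trans | have [] := gP (f i).+1].
have fM i : omega_order M (f i).+1 /\ ~ omega_order M (f i).
  by case: i => [|i]; [have [] := gP 0 | have [] := gP (f i).+1].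
have /choice[w wP] : forall i, exists w, M (0, w) /\ has_order (f i).+1 w.
  by move=> i; have [[w Mw wo] _] := fM i; exists w.
have [|a [i0 ai0] aF] := @fin_dim_lin_dep_comp _ _ _ F _ _ v
  (fun i : 'I_r.+1 => (0, w i)) (ltnSn r).
  by move=> y; apply: Fv; exists y.
(* As [f] is increasing, the least index with nonzero coefficient fixes the order of the
   combination. *)
have [i ai imin] := @arg_minnP _ i0 (fun i => a i != 0) val ai0.
pose z := \sum_i a i *: w i.
have zE : \sum_i a i *: ((0, w i) : Y) = (0, z).
  rewrite [LHS]surjective_pairing fst_sum snd_sum; congr pair.
  by rewrite big1// => j _; exact: scaler0.
have Mz : M (0, z).
  by rewrite -zE; apply: submod_closed_sum => // j; have [] := wP j.
have zo : has_order (f i).+1 z.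
  have aw j k : (k <= (f i).+1)%N -> j != i -> a j * w j k = 0.
    move=> ki ji; have [->|aj] := eqVneq (a j) 0; first by rewrite mul0r.
    have [_ [wj0 _]] := wP j; rewrite wj0 ?mulr0//.
    apply: (leq_ltn_trans ki); rewrite ltnS; apply: f_mono.
    by rewrite ltn_neqAle imin// andbT eq_sym.
  have zi k : (k <= (f i).+1)%N -> z k = a i * w i k.
    move=> ki; rewrite /z omega_sumE (bigD1 i)//= big1 ?addr0// => j.
    exact: aw.
  have [_ [wi0 wi]] := wP i; split=> [k ki|].
    by rewrite zi 1?ltnW// wi0// mulr0.
  by rewrite zi// mulf_neq0.
(* [F] vanishes at [(0, z)], so [M] contains [(0, shift z)], of the excluded order [f i]. *)
have [_] := fM i; apply; exists (shift z); last exact: shift_order.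
have Fz : F (0, z) = 0.
  by rewrite -zE linear_sum -[RHS]aF; apply: eq_bigr => j _; rewrite linearZ.
by have := MF _ Mz; rewrite Fz addr0.
Qed.

(** * The corner of an operator under a continuous norm *)

Lemma continuous_norm_omega (p : X -> R) (B : {linear omega -> X}) :
  is_norm p -> continuous p -> continuous B ->
  exists N, forall w, vanishes_below N w -> B w = 0.
Proof.
move=> [p0 pD pZ] pcont Bcont.
have p00 : p 0 = 0 by rewrite -(scale0r 0) pZ Normc.normc0 mul0r.
have p_ge0 x : 0 <= p x.
  have := pD x (- x); rewrite subrr p00 -scaleN1r pZ normcN Normc.normc1 mul1r.
  by rewrite -mulr2n pmulrn_lge0.
(* A ball of index [j] inside this set contains every sequence vanishing below [j.+1]; on that
   subspace [p \o B] is bounded, hence zero by rescaling. *)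
have : nbhs (0 : omega) [set w | p (B w) < 1].
  have pBcont := @continuous_comp _ _ _ B p 0 (Bcont 0) (pcont (B 0)).
  by apply: (cvgr_lt _ pBcont); rewrite /= linear0 p00 ltr01.
move=> [j [e [e0 eB]]]; exists j.+1 => w wj; apply: p0; apply/eqP.
rewrite eq_le p_ge0 andbT leNgt; apply/negP => pw.
have : p (B (((p (B w))^-1)%:C%C *: w)) < 1.
  apply/eB/omega_ball_agree => // k kj.
  by rewrite [RHS](_ : _ = (p (B w))^-1%:C%C * w k)// wj ?mulr0.
rewrite linearZ pZ /= expr0n /= addr0 sqrtr_sqr.
by rewrite ger0_norm ?invr_ge0// mulVf ?lt0r_neq0// ltxx.
Qed.

Section OmegaCorner.
Variable T : {linear Y -> Y}.

(** The minus sign makes [T + corner_sum] map the summand [omega] into itself. *)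
Definition corner w : X := - (T (0, w)).1.

Lemma corner_linear : linear corner.
Proof.
move=> a w z; rewrite /corner.
have -> : ((0, a *: w + z) : Y) = a *: ((0, w) : Y) + (0, z).
  by congr pair; rewrite /= scaler0 addr0.
by rewrite linearP /= opprD scalerN.
Qed.

HB.instance Definition _ := GRing.isLinear.Build R[i] omega X *:%R corner
  corner_linear.

Definition corner_sum (y : Y) : Y := (corner y.2, 0).

Lemma corner_sum_linear : linear corner_sum.
Proof.
move=> a y z; apply: injective_projections => /=; first exact: linearP.
by rewrite scaler0 addr0.
Qed.

HB.instance Definition _ := GRing.isLinear.Build R[i] Y Y *:%R corner_sum
  corner_sum_linear.

Hypothesis Tcont : continuous T.

Lemma corner_continuous : continuous corner.
Proof.
move=> w; apply: (@continuous_comp _ _ _ (fun w => (T (0, w)).1) -%R); last first.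
  exact: opp_continuous.
apply: (@continuous_comp _ _ _ (fun w => T (0, w)) fst); last exact: cvg_fst.
apply: (@continuous_comp _ _ _ (fun w => (0, w) : Y) T); last exact: Tcont.
apply: (@cvg_pair _ _ _ _ (nbhs 0) (nbhs w) (nbhs_filter w)); first exact: cvg_cst.
exact: cvg_id.
Qed.

Lemma corner_sum_continuous : continuous corner_sum.
Proof.
move=> y; apply: (@cvg_pair _ _ _ _ (nbhs (corner y.2)) (nbhs 0)).
  by apply: (@continuous_comp _ _ _ snd corner);
    [exact: cvg_snd | exact: corner_continuous].
exact: cvg_cst.
Qed.

(** [corner] kills the sequences vanishing below some [N], so the first [N] unit sequences yield the
    whole range. *)
Lemma corner_sum_fin_dim : has_continuous_norm X -> fin_dim (range corner_sum).
Proof.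
move=> [p [pnorm pcont]].
have [N BN] := continuous_norm_omega pnorm pcont corner_continuous.
exists N, (fun i => corner_sum (0, basis_omega R i)); split=> [i|_ [y _ <-]].
  by exists (0, basis_omega R i).
exists (fun i => y.2 i); rewrite [RHS]surjective_pairing fst_sum snd_sum.
congr pair; last by rewrite big1// => i _; exact: scaler0.
apply/eqP; rewrite -subr_eq0 /=; under eq_bigr do rewrite -linearZ.
by rewrite -linear_sum -linearB BN//; exact: vanishes_below_sub_sum_basis.
Qed.

End OmegaCorner.

(** * The summand [omega] as a closed half-space *)

Definition omega_summand : set Y := [set y | y.1 = 0].

Lemma omega_summand_half_space : ~ fin_dim [set: X] -> half_space omega_summand.
Proof.
move=> Xinf; split.
- split=> [|a y z]; rewrite !inE /omega_summand /= => // -> ->.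
  by rewrite scaler0 addr0.
- move=> [n [v [_ vM]]].
  have /(_ (ltnSn n))[] := @fin_dim_lin_dep_comp _ _ _
    (idfun : {linear omega -> omega}) n n.+1
    (fun i => (v i).2) (fun i : 'I_n.+1 => basis_omega R i).
    move=> w; have [|a /(congr1 snd)] := vM (0, w); first by [].
    by rewrite snd_sum => wE; exists a.
  move=> a [i ai0] /(congr1 (fun w : omega => w i)).
  rewrite omega_sumE (bigD1 i)//= /basis_omega eqxx mulr1 big1 => [|j ji].
    by rewrite addr0 => ai; rewrite [a i]ai eqxx in ai0.
  by rewrite (_ : (i == j :> nat) = false) ?mulr0//; apply/negbTE; rewrite eq_sym.
(* First components of vectors spanning the quotient span [X]. *)
- move=> [n [v vM]]; apply: Xinf; exists n, (fun i => (v i).1); split=> // x _.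
  have [a] := vM (x, 0); exists a; apply/eqP; rewrite -subr_eq0.
  by move: p; rewrite /omega_summand /= fst_sum => ->.
Qed.

(** The summand is the zero set of the continuous function [p \o fst]. *)
Lemma omega_summand_closed : has_continuous_norm X -> closed omega_summand.
Proof.
move=> [p [[p0 _ pZ] pcont]].
have -> : omega_summand = (p \o fst) @^-1` [set 0].
  apply/seteqP; split=> y; rewrite /omega_summand /=; last exact: p0.
  by move=> ->; rewrite -(scale0r 0) pZ Normc.normc0 mul0r.
apply: closed_comp; last exact: closed_eq.
by move=> y _; apply: continuous_comp; [exact: cvg_fst | exact: pcont].
Qed.

End SumOmega.

Theorem theorem1 (R : realType) (X : tvsType R[i]) :
  frechet X -> has_continuous_norm X ->
  (forall T : {linear sum_omega X -> sum_omega X},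
      continuous T ->
      exists M : set (sum_omega X),
        [/\ closed M, half_space M & almost_invariant T M])
  <-> ~ fin_dim [set: X].
Proof.
move=> _ Xnorm; split=> [halfT Xfin|Xinf T Tcont].
  have [M [Mcl Mhs]] := halfT (@sum_shift R X) (@sum_shift_continuous R X).
  exact: sum_shift_not_almost_invariant.
exists (@omega_summand R X); split.
- exact: omega_summand_closed.
- exact: omega_summand_half_space.
exists (corner_sum T); split.
- exact: corner_sum_continuous.
- exact: corner_sum_fin_dim.
move=> y My; rewrite /omega_summand /= /corner.
have yE : y = (0, y.2) by rewrite [LHS]surjective_pairing My.
by rewrite -yE subrr.
Qed.
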